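(* Let $R$ be a commutative ring with identity and let $S$ be a multiplicative subset of $R$. (1) If $a,b\in R$ and $ab\in S\text{-}\mathrm{u}(R)$, then $a\in S\text{-}\mathrm{u}(R)$. (2) If $e\in R$ is $S$-idempotent with respect to $s\in S$ (i.e. $se=e^2$), then so is $s-e$. (3) Let $a\in R$. If $sa=a^2b$ (resp. $sa^n=a^{2n}b$) for some $b\in R$, $s\in S$ and $n\ge 1$, then $ab\in S\text{-}\mathrm{idem}(R)$ (resp. $a^nb\in S\text{-}\mathrm{idem}(R)$). (4) The subsets $S\text{-}\mathrm{u}(R)$, $S\text{-}\mathrm{idem}(R)$, $S\text{-}\mathrm{vnr}(R)$ and $S\text{-}\pi\text{-}\mathrm{reg}(R)$ are multiplicatively closed. (5) The intersection $S\text{-}\mathrm{vnr}(R)\cap S\text{-}\mathrm{nil}(R)$ is $S$-torsion. Consequently, so is $S\text{-}\mathrm{idem}(R)\cap S\text{-}\mathrm{nil}(R)$. (6) Let $s,t\in S$. If the set $\{s^n : n\in\mathbb{N}\}$ is finite, then $s\text{-}\mathrm{vnr}(R)\cap t\text{-}\mathrm{nil}(R)$ is uniformly $S$-torsion, and so is $s\text{-}\mathrm{idem}(R)\cap t\text{-}\mathrm{nil}(R)$.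
   Context: A multiplicative subset contains $1$ and is closed under multiplication. For $s\in S$ define: $s\text{-}\mathrm{idem}(R)=\{a\in R: sa=a^2\}$; $s\text{-}\mathrm{vnr}(R)=\{a\in R: sa=a^2b \text{ for some } b\in R\}$; $s\text{-}\mathrm{nil}(R)=\{a\in R: sa^n=0\text{ for some integer } n\ge1\}$. Define $S\text{-}\mathrm{idem}(R)$, $S\text{-}\mathrm{vnr}(R)$, $S\text{-}\mathrm{nil}(R)$ as the unions over $s\in S$ of the corresponding sets; also $S\text{-}\mathrm{u}(R)=\{a\in R: ab\in S\text{ for some } b\in R\}$ and $S\text{-}\pi\text{-}\mathrm{reg}(R)=\{a\in R: sa^n=a^{2n}b\text{ for some } b\in R, s\in S, n\ge1\}$. A subset $A\subseteq R$ is $S$-torsion if for every $a\in A$ there is $s\in S$ with $sa=0$; it is uniformly $S$-torsion if there is a single $s\in S$ with $sa=0$ for all $a\in A$. *)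

(* Defs.v *)
From mathcomp Require Import all_boot all_algebra.
From mathcomp Require Import boolp classical_sets cardinality.

Set Implicit Arguments.
Unset Strict Implicit.
Unset Printing Implicit Defensive.

Import GRing.Theory.
Local Open Scope classical_set_scope.
Local Open Scope ring_scope.

(* Rings are [comPzRingType]s, so that the zero ring is allowed. *)

(* [GRing.mulr_closed] is the same condition for boolean predicates. *)
Definition multiplicative_subset (R : comPzRingType) (S : set R) : Prop :=
  S 1 /\ (forall a b, S a -> S b -> S (a * b)).

Definition elt_idem (R : comPzRingType) (s : R) : set R :=
  [set a | s * a = a ^+ 2].

Definition elt_vnr (R : comPzRingType) (s : R) : set R :=
  [set a | exists b, s * a = a ^+ 2 * b].

Definition elt_nil (R : comPzRingType) (s : R) : set R :=
  [set a | exists2 n : nat, (1 <= n)%N & s * a ^+ n = 0].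

Definition S_idem (R : comPzRingType) (S : set R) : set R :=
  \bigcup_(s in S) elt_idem s.

Definition S_vnr (R : comPzRingType) (S : set R) : set R :=
  \bigcup_(s in S) elt_vnr s.

Definition S_nil (R : comPzRingType) (S : set R) : set R :=
  \bigcup_(s in S) elt_nil s.

Definition S_unit (R : comPzRingType) (S : set R) : set R :=
  [set a | exists b, S (a * b)].

Definition S_pireg (R : comPzRingType) (S : set R) : set R :=
  [set a | exists b s (n : nat),
     [/\ S s, (1 <= n)%N & s * a ^+ n = a ^+ (2 * n) * b]].

Definition S_torsion (R : comPzRingType) (S A : set R) : Prop :=
  forall a, A a -> exists2 s, S s & s * a = 0.

Definition uniformly_S_torsion (R : comPzRingType) (S A : set R) : Prop :=
  exists2 s, S s & forall a, A a -> s * a = 0.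

(* Main.v *)
(** If [s a = a^2 b], then [s^k a = a^(k+1) b^k] for all [k]; so if also
    [t a^n = 0], then [t s^n] kills [a]. The exponent depends on [a], but when [s]
    has finitely many powers, their product is a multiple of each of them. *)

Require Import Defs.
From mathcomp Require Import all_boot all_algebra.
From mathcomp Require Import boolp classical_sets cardinality.

Set Implicit Arguments.
Unset Strict Implicit.
Unset Printing Implicit Defensive.

Import GRing.Theory.
Local Open Scope classical_set_scope.
Local Open Scope ring_scope.

Section SRegularity.
Variables (R : comPzRingType) (S : set R).
Implicit Types a b s t : R.

(** Taking [b = 1] suffices; the torsion claims for idempotents thus reduce to those for regular
    elements. *)
Lemma elt_idem_sub_vnr s : elt_idem s `<=` elt_vnr s.
Proof. by move=> a /= sa; exists 1; rewrite mulr1. Qed.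

Lemma S_idem_sub_vnr : S_idem S `<=` S_vnr S.
Proof. by move=> a [s Ss /elt_idem_sub_vnr sa]; exists s. Qed.

(** Multiplying the hypothesis by [b] gives [s (a b) = a^2 b^2]. *)
Lemma vnr_mul_idem s a b : s * a = a ^+ 2 * b -> elt_idem s (a * b).
Proof. by move=> sa; rewrite /elt_idem /= mulrA sa exprMn -mulrA -expr2. Qed.

Lemma vnr_exp s a b k : s * a = a ^+ 2 * b -> s ^+ k * a = a ^+ k.+1 * b ^+ k.
Proof.
move=> sa; elim: k => [|k IHk]; first by rewrite !expr0 mul1r mulr1.
(* One factor [s] meets one factor [a] of [a^(k+1) b^k], and [s a] becomes [a^2 b]. *)
rewrite exprS -mulrA IHk exprS !mulrA sa (exprS b) !exprS expr0.
by rewrite mulr1 -!mulrA; congr (_ * (_ * _)); rewrite mulrCA.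
Qed.

(** Both sides are [k]-th powers of the sides of the hypothesis. This lets two elements with
    different exponents be brought to a common one. *)
Lemma pireg_exp s a b n k : s * a ^+ n = a ^+ (2 * n) * b ->
  s ^+ k * a ^+ (n * k) = a ^+ (2 * (n * k)) * b ^+ k.
Proof.
by move=> sa; rewrite mulnA [RHS]mulrC !(exprM _ _ k) -!exprMn sa mulrC.
Qed.

Lemma vnr_nil_ann s t a :
  elt_vnr s a -> elt_nil t a -> exists k, t * s ^+ k * a = 0.
Proof.
move=> [b sa] [n _ ta]; exists n.
by rewrite -mulrA (vnr_exp n sa) exprSr !mulrA ta !mul0r.
Qed.

Hypothesis mulS : multiplicative_subset S.

Lemma multiplicative_subset_exp s n : S s -> S (s ^+ n).
Proof.
case: mulS => S1 SM Ss; elim: n => [|n IHn]; first by rewrite expr0.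
by rewrite exprS; apply: SM.
Qed.

Lemma multiplicative_S_unit : multiplicative_subset (S_unit S).
Proof.
case: mulS => S1 SM; split; first by exists 1; rewrite mulr1.
by move=> a b [c Sac] [d Sbd]; exists (c * d); rewrite mulrACA; apply: SM.
Qed.

Lemma multiplicative_S_idem : multiplicative_subset (S_idem S).
Proof.
case: mulS => S1 SM; split.
  by exists 1 => //; rewrite /elt_idem /= expr1n mulr1.
move=> a c [s Ss sa] [t St tc]; exists (s * t); first exact: SM.
by rewrite /elt_idem /= mulrACA sa tc exprMn.
Qed.

Lemma multiplicative_S_vnr : multiplicative_subset (S_vnr S).
Proof.
case: mulS => S1 SM; split.
  by exists 1 => //; exists 1; rewrite expr1n.
move=> a c [s Ss [b sa]] [t St [d tc]]; exists (s * t); first exact: SM.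
by exists (b * d); rewrite mulrACA sa tc mulrACA exprMn.
Qed.

Lemma multiplicative_S_pireg : multiplicative_subset (S_pireg S).
Proof.
case: mulS => S1 SM; split.
  by exists 1, 1, 1%N; split; rewrite // !expr1n.
move=> a c [b [s [n [Ss n_gt0 sa]]]] [d [t [m [St m_gt0 tc]]]].
(* The common exponent is [n m]: the relation for [a] is raised to the power [m], that for [c] to
   the power [n]. *)
exists (b ^+ m * d ^+ n), (s ^+ m * t ^+ n), (n * m)%N; split.
- by apply: SM; apply: multiplicative_subset_exp.
- by rewrite muln_gt0 n_gt0.
- rewrite !exprMn mulrACA [RHS]mulrACA (pireg_exp m sa).
  by rewrite [in t ^+ n * _]mulnC (pireg_exp n tc) (mulnC m).
Qed.

Lemma S_torsion_vnr_nil : S_torsion S (S_vnr S `&` S_nil S).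
Proof.
move=> a [[s Ss sa] [t St ta]]; have [k tka] := vnr_nil_ann sa ta.
exists (t * s ^+ k) => //; apply: mulS.2 => //.
exact: multiplicative_subset_exp.
Qed.

Lemma finite_common_multiple (A : set R) : finite_set A -> A `<=` S ->
  exists2 p, S p & forall x, A x -> exists y, p = y * x.
Proof.
case: mulS => S1 SM /finite_seqP[r ->] rS.
exists (\prod_(x <- r) x).
  by rewrite big_seq; elim/big_ind: _ => // x; apply: rS.
(* The cofactor [y] is the product over the list with one occurrence of [x] removed. *)
by move=> x xr; rewrite (big_rem x) //= mulrC; eexists.
Qed.

Lemma uniformly_S_torsion_vnr_nil s t :
  S s -> S t -> finite_set (range (fun n : nat => s ^+ n)) ->
  uniformly_S_torsion S (elt_vnr s `&` elt_nil t).
Proof.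
move=> Ss St /finite_common_multiple[|p Sp pP].
  by move=> _ [n _ <-]; apply: multiplicative_subset_exp.
(* Since [p = y s^k] for whichever [k] suits [a], [t p a = y (t s^k a) = 0]. *)
exists (t * p); first exact: mulS.2.
move=> a [sa ta]; have [k tka] := vnr_nil_ann sa ta.
have [|y ->] := pP (s ^+ k); first by exists k.
by rewrite mulrCA -mulrA tka mulr0.
Qed.

End SRegularity.

Theorem proposition2p6 (R : comPzRingType) (S : set R)
    (mulS : multiplicative_subset S) :
  (* (1) *)
  (forall a b : R, S_unit S (a * b) -> S_unit S a) /\
  (* (2) *)
  (forall s e : R, S s -> elt_idem s e -> elt_idem s (s - e)) /\
  (* (3) *)
  ((forall a b s : R, S s -> s * a = a ^+ 2 * b -> S_idem S (a * b)) /\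
   (forall (a b s : R) (n : nat), S s -> (1 <= n)%N ->
      s * a ^+ n = a ^+ (2 * n) * b -> S_idem S (a ^+ n * b))) /\
  (* (4) *)
  [/\ multiplicative_subset (S_unit S), multiplicative_subset (S_idem S),
      multiplicative_subset (S_vnr S) & multiplicative_subset (S_pireg S)] /\
  (* (5) *)
  (S_torsion S (S_vnr S `&` S_nil S) /\
   S_torsion S (S_idem S `&` S_nil S)) /\
  (* (6) *)
  (forall s t : R, S s -> S t ->
     finite_set (range (fun n : nat => s ^+ n)) ->
     uniformly_S_torsion S (elt_vnr s `&` elt_nil t) /\
     uniformly_S_torsion S (elt_idem s `&` elt_nil t)).
Proof.
split; first by move=> a b [c Sabc]; exists (b * c); rewrite mulrA.
split.
  move=> s e _; rewrite /elt_idem /= => se.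
  (* With [s e = e^2], both sides reduce to [s^2 - e^2]. *)
  by rewrite sqrrB mulrBr se mulr2n opprD addrA subrK.
split.
  (* The second case is the first applied to [a^n], as [a^(2n) = (a^n)^2]. *)
  split=> [a b s Ss sa|a b s n Ss _ sa]; exists s => //; apply: vnr_mul_idem => //.
  by rewrite -exprM mulnC.
split.
  split; [exact: multiplicative_S_unit | exact: multiplicative_S_idem
         | exact: multiplicative_S_vnr | exact: multiplicative_S_pireg].
split.
  split; first exact: S_torsion_vnr_nil.
  by move=> a [/S_idem_sub_vnr sa ta]; apply: S_torsion_vnr_nil.
move=> s t Ss St fins.
have [p Sp pP] := uniformly_S_torsion_vnr_nil mulS Ss St fins.
split; exists p => // a [sa ta]; apply: pP; split=> //.
exact: elt_idem_sub_vnr.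
Qed.
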